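(* Consider the system $$X(s+1)=(1-a(s))X(s)+a(s)\big[\Lambda(s)P(s)X(s)C(s)^\top+(I_n-\Lambda(s))X(0)\big],\quad s=0,1,\ldots,$$ with state $X(s)\in\mathbb{R}^{n\times m}$, where $\Lambda(s)\in\mathbb{R}^{n\times n}$, $P(s)\in\mathbb{R}^{n\times n}$ and $C(s)\in\mathbb{R}^{m\times m}$ are independent random matrix sequences (all the matrices $\Lambda(s),P(s),C(s)$, $s\ge0$, being mutually independent) with invariant expectations $\Lambda$, $P$ and $C$ respectively. Assume $\mathbb{E}\|\Lambda(s)\|_2^2$, $\mathbb{E}\|P(s)\|_2^2$ and $\mathbb{E}\|C(s)\|_2^2$ are uniformly bounded in $s$. Suppose $P$ and $C$ are row-stochastic matrices, $\Lambda$ is a diagonal matrix with $\mathbf{0}_{n\times n}\le\Lambda<I_n$ (i.e. with all diagonal entries in $[0,1)$), and the gain function $a(s)$ satisfies (A2). Then for any initial state, $X(s)$ converges to $X^*$ in mean square, where $X^*$ is the unique solution of the equation $$X=\Lambda PXC^\top+(I_n-\Lambda)X(0).$$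
   Context: (A2): $\{a(s)\}$ are non-negative real numbers independent of the state sequence $\{X(s)\}$ with $\sum_{s=0}^\infty a(s)=\infty$ and $\sum_{s=0}^\infty a^2(s)<\infty$. The initial state $X(0)$ is a matrix in $\mathbb{R}^{n\times m}$. Convergence in mean square of $X(s)$ to $X^*$ means $\lim_{s\to\infty}\mathbb{E}\|X(s)-X^*\|^2=0$ (any matrix norm, e.g. the Euclidean norm of the vector of entries). *)

(* Defs.v *)
From HB Require Import structures.
From mathcomp Require Import all_boot all_order all_algebra finmap.
From mathcomp Require Import all_classical all_reals all_analysis.

Set Implicit Arguments.
Unset Strict Implicit.
Unset Printing Implicit Defensive.

Import Order.TTheory GRing.Theory Num.Theory.
Import numFieldNormedType.Exports.

Local Open Scope classical_set_scope.
Local Open Scope ring_scope.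

(* Euclidean norm of the vector of entries (the library norm on matrices is
   the max norm). *)
Definition mx_eucl {R : realType} {p q : nat} (A : 'M[R]_(p, q)) : R :=
  Num.sqrt (\sum_(i < p) \sum_(j < q) A i j ^+ 2).

(* Operator norm ||A||_2 induced by the Euclidean vector norms. *)
Definition mx_norm2 {R : realType} {p q : nat} (A : 'M[R]_(p, q)) : R :=
  sup [set mx_eucl (A *m x) | x in [set x : 'cV[R]_q | mx_eucl x <= 1]].

Definition row_stochastic {R : realType} {p : nat} (A : 'M[R]_p) : Prop :=
  (forall i j, 0 <= A i j) /\ (forall i, \sum_(j < p) A i j = 1).

(* Entrywise measurability is measurability for the Borel sigma-algebra of
   'M[R]_(p, q). *)
Definition random_mx {d : measure_display} {T : measurableType d}
    {R : realType} {p q : nat} (M : T -> 'M[R]_(p, q)) : Prop :=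
  forall i j, measurable_fun [set: T] (fun w => M w i j).

Definition sigma_mx {d : measure_display} {T : measurableType d}
    {R : realType} {p q : nat} (M : T -> 'M[R]_(p, q)) : set (set T) :=
  <<s [set E | exists i j,
         preimage_set_system [set: T] (fun w => M w i j) measurable E] >>.

Definition has_mean_mx {d : measure_display} {T : measurableType d}
    {R : realType} (Pr : probability T R) {p q : nat}
    (M : T -> 'M[R]_(p, q)) (A : 'M[R]_(p, q)) : Prop :=
  forall i j, ('E_Pr[fun w => M w i j] = (A i j)%:E)%E.

Definition mutually_independent {d : measure_display} {T : measurableType d}
    {R : realType} (Pr : probability T R) {I : choiceType}
    (F : I -> set (set T)) : Prop :=
  forall (J : {fset I}) (E : I -> set T),
    (forall i, i \in J -> F i (E i)) ->
    Pr (\bigcap_(i in [set` J]) E i) = (\prod_(i <- J) Pr (E i))%E.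

(* The sum type indexes the single family formed by all the M1 s, M2 s
   and M3 s, s : nat, so that independence holds jointly across the three
   sequences and across time. *)
Definition independent_mx_sequences {d : measure_display}
    {T : measurableType d} {R : realType} (Pr : probability T R)
    {p1 q1 p2 q2 p3 q3 : nat} (M1 : nat -> T -> 'M[R]_(p1, q1))
    (M2 : nat -> T -> 'M[R]_(p2, q2)) (M3 : nat -> T -> 'M[R]_(p3, q3)) :
    Prop :=
  mutually_independent Pr
    (fun k : nat + (nat + nat) =>
       match k with
       | inl s => sigma_mx (M1 s)
       | inr (inl s) => sigma_mx (M2 s)
       | inr (inr s) => sigma_mx (M3 s)
       end).

Definition bounded_second_moment {d : measure_display}
    {T : measurableType d} {R : realType} (Pr : probability T R)
    {p q : nat} (M : nat -> T -> 'M[R]_(p, q)) : Prop :=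
  exists B : R, forall s, ('E_Pr[fun w => (mx_norm2 (M s w) ^+ 2)%R] <= B%:E)%E.

Definition cvg_mean_square {d : measure_display}
    {T : measurableType d} {R : realType} (Pr : probability T R)
    {p q : nat} (X : nat -> T -> 'M[R]_(p, q)) (Y : 'M[R]_(p, q)) : Prop :=
  ('E_Pr[fun w => (mx_eucl (X s w - Y) ^+ 2)%R])%E @[s --> \oo] --> 0%:E.

(* Main.v *)
Require Import Defs.
From HB Require Import structures.
From mathcomp Require Import all_boot all_order all_algebra finmap.
From mathcomp Require Import all_classical all_reals all_analysis.
From mathcomp Require Import measurable_realfun ring lra.

Import Order.TTheory GRing.Theory Num.Theory.
Import numFieldNormedType.Exports.

Local Open Scope classical_set_scope.
Local Open Scope ring_scope.

(** The error [Z s = X s - Xstar] satisfies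
    [Z (s+1) = Z s + a s *: drift s (Z s)], where, the matrices of time [s] being
    independent of [Z s], the drift has conditional mean
    [Lam P (Z s) C^T - Z s] and second moment [O(1 + u s)], with [u s] the largest
    second moment of an entry of [Z s]. The entries of [Lam P Y C^T] are averages
    of those of [Y] scaled by at most [rho < 1], and by AM-GM all cross moments
    of entries of [Z s] are bounded by [u s]; working with [u] rather than with
    the Euclidean norm is what makes the mean dynamics a contraction. Hence
    [u (s+1) <= (1 - 2 (1 - rho) a + c a^2) u s + c a^2], which forces
    [u s --> 0]. *)

(** * Independence of sigma-algebras and factorisation of expectations *)

Section independence.
Context {d : measure_display} {T : measurableType d} {R : realType}.
Variable Pr : probability T R.

Definition independent_systems (G H : set (set T)) : Prop :=
  forall A B, <<s G >> A -> <<s H >> B -> Pr (A `&` B) = (Pr A * Pr B)%E.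

Lemma gen_sigma_measurable (G : set (set T)) :
  G `<=` measurable -> <<s G >> `<=` measurable.
Proof. by apply: smallest_sub; exact: sigma_algebra_measurable. Qed.

(** A generating system for the join of the [F i] with [i] in [J]; the join itself is
    [<<s union_system F J >>]. *)
Definition union_system {I : choiceType} (F : I -> set (set T)) (J : {fset I}) :
    set (set T) := [set A | exists2 i, i \in J & F i A].

Lemma sigma_algebra_setI (F : set (set T)) :
  sigma_algebra setT F -> setI_closed F.
Proof.
move=> sF A B; rewrite -(sigma_algebra_id sF) => FA FB.
exact: (@measurableI _ (g_sigma_algebraType F)).
Qed.

Lemma sigma_algebra_setT (F : set (set T)) : sigma_algebra setT F -> F setT.
Proof. by case=> F0 FC _; rewrite -(setD0 setT); exact: FC. Qed.

(** Pi-lambda argument. Intersections of one event per index of [J] form a pi-system generating the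
    join. For [B] in [F k], mutual independence makes the two sides agree on it as finite measures
    in [A], hence on the whole join. *)
Lemma independent_union {I : choiceType} (F : I -> set (set T)) (J : {fset I})
    (k : I) :
  (forall i, sigma_algebra setT (F i)) -> (forall i, F i `<=` measurable) ->
  mutually_independent Pr F -> k \notin J ->
  independent_systems (union_system F J) (F k).
Proof.
move=> Fsig Fm Find kJ A B sA; rewrite sigma_algebra_id// => FB.
have FT i := sigma_algebra_setT _ (Fsig i).
have mB : measurable B := Fm _ _ FB.
pose PiS : set (set T) := [set A | exists2 E : I -> set T,
  (forall i, i \in J -> F i (E i)) & A = \bigcap_(i in [set` J]) E i].
have PiT : PiS setT.
  by exists (fun=> setT) => //; rewrite bigcapT.
have PiI : setI_closed PiS.
  move=> _ _ [E1 FE1 ->] [E2 FE2 ->]; exists (fun i => E1 i `&` E2 i).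
    by move=> i iJ; apply: sigma_algebra_setI => //; [exact: FE1|exact: FE2].
  by rewrite bigcapI.
have Pim : PiS `<=` measurable.
  move=> _ [E FE ->]; apply: fin_bigcap_measurable; first exact: finite_fset.
  by move=> i /= iJ; exact/Fm/FE.
have PiB C : PiS C -> Pr (C `&` B) = (Pr C * Pr B)%E.
  move=> [E FE ->].
  pose E' i := if i == k then B else E i.
  have E'J i : i \in J -> E' i = E i.
    by rewrite /E'; case: eqP => // ->; rewrite (negPf kJ).
  have E'k : E' k = B by rewrite /E' eqxx.
  have -> : \bigcap_(i in [set` J]) E i `&` B =
            \bigcap_(i in [set` (k |` J)%fset]) E' i.
    rewrite eqEsubset; split=> x /=.
      move=> [EJ Bx] i /=; rewrite in_fset1U => /predU1P[->|iJ].
        by rewrite E'k.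
      by rewrite E'J//; exact: EJ.
    move=> E'x; split; last by rewrite -E'k; apply: E'x; rewrite /= fset1U1.
    by move=> i /= iJ; rewrite -E'J//; apply: E'x; rewrite /= in_fset1U iJ orbT.
  rewrite Find; last first.
    move=> i; rewrite in_fset1U => /predU1P[->|iJ]; first by rewrite E'k.
    by rewrite E'J//; exact: FE.
  rewrite big_fsetU1//= E'k muleC; congr (_ * _)%E.
  by rewrite Find//; apply: eq_big_seq => i iJ; rewrite E'J.
have Pr_fin C : measurable C -> Pr C \is a fin_num by move=> mC; exact: fin_num_measure.
(* The two finite measures to identify: [Pr] restricted to [B], and [Pr] scaled by the probability
   of [B]. *)
pose m1 := mrestr Pr mB.
pose m2 := mscale (NngNum (fine_ge0 (measure_ge0 Pr B))) Pr.
have m2E C : m2 C = (Pr B * Pr C)%E by rewrite /m2 /mscale /= fineK ?Pr_fin.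
have -> : Pr (A `&` B) = m1 A by [].
have -> : (Pr A * Pr B)%E = m2 A.
  by rewrite m2E muleC.
apply: (g_sigma_algebra_measure_unique PiS Pim (fun=> setT)) => //.
- by rewrite bigcup_const.
- by move=> C PiC; rewrite -[RHS]/(m2 C) m2E muleC -PiB.
- move=> _; rewrite -[X in (X < _)%E]/(Pr (setT `&` B)) setTI -ge0_fin_numE ?Pr_fin//.
- apply: sub_sigma_algebra2 A sA => C [i iJ FiC].
  exists (fun j => if j == i then C else setT).
    by move=> j _; case: eqP => [->|].
  rewrite eqEsubset; split=> x /=.
    by move=> Cx j _; case: eqP.
  by move=> /(_ i iJ); rewrite eqxx.
Qed.

(* The law of [w |-> (w, w)] on the product of the two sub-sigma-algebras is the
   product of the restrictions of [Pr], so Fubini applies. *)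
Lemma expectation_indep (G H : set (set T)) (f g : T -> R) :
  G `<=` measurable -> H `<=` measurable -> independent_systems G H ->
  measurable_fun [set: g_sigma_algebraType G] f ->
  measurable_fun [set: g_sigma_algebraType H] g ->
  Pr.-integrable setT (EFin \o f) -> Pr.-integrable setT (EFin \o g) ->
  Pr.-integrable setT (EFin \o (f \* g)) /\
  \int[Pr]_w (f w * g w) = \int[Pr]_w f w * \int[Pr]_w g w.
Proof.
move=> mG mH GH mf mg intf intg.
(* Identity maps whose codomains carry the coarser sigma-algebras generated by [G] and [H]. *)
pose i1 : T -> g_sigma_algebraType G := id.
pose i2 : T -> g_sigma_algebraType H := id.
have mi1 : measurable_fun setT i1.
  by move=> _ Y mY; rewrite setTI; exact: (gen_sigma_measurable _ mG).
have mi2 : measurable_fun setT i2.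
  by move=> _ Y mY; rewrite setTI; exact: (gen_sigma_measurable _ mH).
pose i12 w := (i1 w, i2 w).
have mi12 : measurable_fun setT i12.
  exact: measurable_fun_pair.
pose X1 : {mfun T >-> g_sigma_algebraType G} :=
  HB.pack i1 (isMeasurableFun.Build _ _ _ _ _ mi1).
pose X2 : {mfun T >-> g_sigma_algebraType H} :=
  HB.pack i2 (isMeasurableFun.Build _ _ _ _ _ mi2).
pose X12 : {mfun T >-> (g_sigma_algebraType G * g_sigma_algebraType H)%type} :=
  HB.pack i12 (isMeasurableFun.Build _ _ _ _ _ mi12).
pose P1 := distribution Pr X1.
pose P2 := distribution Pr X2.
have prodE (Y : set (g_sigma_algebraType G * g_sigma_algebraType H)%type) :
    measurable Y -> (P1 \x P2)%E Y = distribution Pr X12 Y.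
  apply: product_measure_unique => A B mA mB.
  rewrite /P1 /P2 /distribution /pushforward /=.
  exact: GH.
have intP1 : P1.-integrable setT (EFin \o f).
  by apply: integrable_pushforward => //; exact/measurable_EFinP.
have intP2 : P2.-integrable setT (EFin \o g).
  by apply: integrable_pushforward => //; exact/measurable_EFinP.
pose h (z : g_sigma_algebraType G * g_sigma_algebraType H) : \bar R :=
  (f z.1 * g z.2)%:E.
have mh : measurable_fun setT h.
  apply/measurable_EFinP; apply: measurable_funM.
    exact: (measurableT_comp mf measurable_fst).
  exact: (measurableT_comp mg measurable_snd).
(* By Tonelli, the iterated integral of the absolute value factors into two finite integrals. *)
have inth : (P1 \x P2)%E.-integrable setT h.
  apply/integrable12ltyP => //.
  under eq_integral => x _.
    under eq_integral => y _ do rewrite /h /= normrM EFinM.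
    over.
  under eq_integral => x _.
    rewrite integralZl//; last exact: integrable_norm.
    rewrite muleC.
    over.
  have fin1 : (\int[P1]_x `|f x|%:E)%E \is a fin_num.
    by apply: integrable_fin_num => //; exact: integrable_norm.
  have fin2 : (\int[P2]_x `|g x|%:E)%E \is a fin_num.
    by apply: integrable_fin_num => //; exact: integrable_norm.
  rewrite -(fineK fin2) integralZl//; last exact: integrable_norm.
  by rewrite -(fineK fin1) -EFinM ltry.
have inthD : (distribution Pr X12).-integrable setT h.
  apply/integrableP; split => //.
  move/integrableP: inth => [_]; apply: le_lt_trans.
  rewrite le_eqVlt; apply/orP; left; apply/eqP.
  by apply: eq_measure_integral => Y mY _; exact/esym/prodE.
have intfg : Pr.-integrable setT (EFin \o (f \* g)).
  apply/integrableP; split.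
    apply/measurable_EFinP; apply: measurable_funM.
      exact: (measurableT_comp mf mi1).
    exact: (measurableT_comp mg mi2).
  move/integrableP: inthD => [_].
  rewrite ge0_integral_distribution//; exact: measurableT_comp.
split=> //; rewrite /Rintegral.
have -> : (\int[Pr]_w (f w * g w)%:E = \int[distribution Pr X12]_z h z)%E.
  by rewrite integral_distribution.
have <- : (\int[P1 \x P2]_z h z = \int[distribution Pr X12]_z h z)%E.
  by apply: eq_measure_integral => Y mY _; exact: prodE.
rewrite -integral12_prod_meas1//.
have -> : (\int[Pr]_w (f w)%:E = \int[P1]_w (f w)%:E)%E.
  by rewrite /P1 integral_distribution//; exact/measurable_EFinP.
have -> : (\int[Pr]_w (g w)%:E = \int[P2]_w (g w)%:E)%E.
  by rewrite /P2 integral_distribution//; exact/measurable_EFinP.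
rewrite /fubini_F /h.
under eq_integral => x _.
  under eq_integral => y _ do rewrite /= EFinM.
  rewrite integralZl// muleC.
  over.
have fin1 : (\int[P1]_x (f x)%:E)%E \is a fin_num by exact: integrable_fin_num.
have fin2 : (\int[P2]_x (g x)%:E)%E \is a fin_num by exact: integrable_fin_num.
by rewrite -(fineK fin2) integralZl// -(fineK fin1) -EFinM /= mulrC.
Qed.
End independence.

(** * Integrable and square-integrable real random variables *)

Section square_integrable.
Context {d : measure_display} {T : measurableType d} {R : realType}.
Variable Pr : probability T R.
Implicit Types f g : T -> R.

Definition intble f := Pr.-integrable setT (EFin \o f).

Lemma intbleD f g : intble f -> intble g -> intble (fun w => f w + g w).
Proof. by move=> If Ig; exact: (integrableD measurableT If Ig). Qed.

Lemma intbleZ (k : R) f : intble f -> intble (fun w => k * f w).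
Proof. by move=> If; exact: (integrableZl measurableT k If). Qed.

Lemma intble_cst (k : R) : intble (fun=> k).
Proof. exact: finite_measure_integrable_cst. Qed.

Lemma intble_sum (I : finType) (f : I -> T -> R) :
  (forall i, intble (f i)) -> intble (fun w => \sum_i f i w) /\
  \int[Pr]_w (\sum_i f i w) = \sum_i \int[Pr]_w f i w.
Proof.
move=> If; elim: (index_enum I) => [|i r [IHi IHe]].
  under eq_fun do rewrite big_nil.
  split; first exact: intble_cst.
  by rewrite big_nil Rintegral_cst// mul0r.
under eq_fun do rewrite big_cons.
split; first exact: intbleD.
by rewrite big_cons -IHe; exact: (RintegralD measurableT (If i) IHi).
Qed.

Lemma Rintegral_prob_cst (k : R) : \int[Pr]_w k = k.
Proof.
rewrite Rintegral_cst// (_ : fine _ = 1) ?mulr1//.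
by rewrite -[RHS]/(fine 1%E) -(probability_setT Pr).
Qed.

Definition sqint f := measurable_fun setT f /\ intble (fun w => f w ^+ 2).

Lemma intble_le f g : measurable_fun setT f -> intble g ->
  (forall w, `|f w| <= g w) -> intble f.
Proof.
move=> mf Ig fg; apply: (le_integrable measurableT _ _ Ig).
  exact/measurable_EFinP.
by move=> w _ /=; rewrite lee_fin (le_trans (fg w))// ler_norm.
Qed.

Lemma intble_mul_sqint f g : sqint f -> sqint g -> intble (fun w => f w * g w).
Proof.
move=> [mf If] [mg Ig].
apply: (@intble_le _ (fun w => f w ^+ 2 + g w ^+ 2)).
- exact: measurable_funM.
- exact: intbleD.
- move=> w; rewrite normrM -(real_normK (num_real (f w))) -(real_normK (num_real (g w))).
  by have := sqr_ge0 (`|f w| - `|g w|); have := sqr_ge0 (`|f w| + `|g w|); nra.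
Qed.

Lemma sqint_cst (k : R) : sqint (fun=> k).
Proof. by split; [exact: measurable_cst|exact: intble_cst]. Qed.

Lemma intble_sqint f : sqint f -> intble f.
Proof.
move=> sf; have := intble_mul_sqint _ _ sf (sqint_cst 1).
by under eq_fun do rewrite mulr1.
Qed.

Lemma sqintD f g : sqint f -> sqint g -> sqint (fun w => f w + g w).
Proof.
move=> sf sg; split; first exact: measurable_funD sf.1 sg.1.
under eq_fun do rewrite sqrrD -mulr_natl.
apply: intbleD; last exact: sg.2.
by apply: intbleD; [exact: sf.2|apply: intbleZ; exact: intble_mul_sqint].
Qed.

Lemma sqintZ (k : R) f : sqint f -> sqint (fun w => k * f w).
Proof.
move=> sf; split; first by apply: measurable_funM sf.1; exact: measurable_cst.
by under eq_fun do rewrite exprMn; apply: intbleZ sf.2.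
Qed.

Lemma abs_cross_moment_le f g (u : R) : sqint f -> sqint g ->
  \int[Pr]_w (f w ^+ 2) <= u -> \int[Pr]_w (g w ^+ 2) <= u ->
  `|\int[Pr]_w (f w * g w)| <= u.
Proof.
move=> sf sg fu gu.
apply: (le_trans (le_normr_Rintegral measurableT (intble_mul_sqint _ _ sf sg))).
apply: (@le_trans _ _ (\int[Pr]_w (2^-1 * (f w ^+ 2 + g w ^+ 2)))).
  apply: le_Rintegral => //.
  - by apply: integrable_norm; exact: intble_mul_sqint.
  - by apply: intbleZ; apply: intbleD; [exact: sf.2|exact: sg.2].
  - move=> w _; rewrite normrM -(real_normK (num_real (f w))) -(real_normK (num_real (g w))).
    by have := sqr_ge0 (`|f w| - `|g w|); nra.
rewrite RintegralZl//; last by apply: intbleD; [exact: sf.2|exact: sg.2].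
by rewrite RintegralD//; [lra|exact: sf.2|exact: sg.2].
Qed.

Lemma sq_moment_ge0 f : 0 <= \int[Pr]_w (f w ^+ 2).
Proof. by apply: Rintegral_ge0 => w _; exact: sqr_ge0. Qed.

(** Second moments are [O(v s)] with a single constant for the whole family. The index type is free:
    [nat] for a process, [unit] for a single random variable. *)
Definition sq_dominated {S : Type} (v : S -> R) (f : S -> T -> R) : Prop :=
  exists2 c, 0 <= c &
    forall s, sqint (f s) /\ \int[Pr]_w (f s w ^+ 2) <= c * v s.

Lemma sq_dominatedD {S : Type} (v : S -> R) (f g : S -> T -> R) :
  sq_dominated v f -> sq_dominated v g ->
  sq_dominated v (fun s w => f s w + g s w).
Proof.
move=> [c c0 fc] [c' c'0 gc]; exists (2 * c + 2 * c'); first by lra.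
move=> s; have [sf fs] := fc s; have [sg gs] := gc s.
split; first exact: sqintD.
apply: (@le_trans _ _ (\int[Pr]_w (2 * f s w ^+ 2 + 2 * g s w ^+ 2))).
  apply: le_Rintegral => //.
  - exact: (sqintD _ _ sf sg).2.
  - by apply: intbleD; apply: intbleZ; [exact: sf.2|exact: sg.2].
  - by move=> w _; have := sqr_ge0 (f s w - g s w); nra.
have If := sf.2; have Ig := sg.2.
rewrite RintegralD ?RintegralZl//; [|exact: intbleZ|exact: intbleZ].
by lra.
Qed.

Lemma sq_dominatedZ {S : Type} (v : S -> R) (k : R) (f : S -> T -> R) :
  sq_dominated v f -> sq_dominated v (fun s w => k * f s w).
Proof.
move=> [c c0 fc]; exists (k ^+ 2 * c); first by rewrite mulr_ge0// sqr_ge0.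
move=> s; have [sf fs] := fc s; split; first exact: sqintZ.
under eq_Rintegral do rewrite exprMn.
by rewrite RintegralZl//; [rewrite -[leRHS]mulrA ler_wpM2l// sqr_ge0|exact: sf.2].
Qed.

(** The condition [1 <= v s] is what lets [v] absorb inhomogeneous terms. *)
Lemma sq_dominated_cst {S : Type} (v : S -> R) (k : R) : (forall s, 1 <= v s) ->
  sq_dominated v (fun _ _ => k).
Proof.
move=> v1; exists (k ^+ 2); first exact: sqr_ge0.
move=> s; split; first exact: sqint_cst.
by rewrite Rintegral_prob_cst ler_peMr// sqr_ge0.
Qed.

Lemma sq_dominated_sum {S : Type} (v : S -> R) (I : finType) (f : I -> S -> T -> R) :
  (forall s, 1 <= v s) -> (forall i, sq_dominated v (f i)) ->
  sq_dominated v (fun s w => \sum_i f i s w).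
Proof.
move=> v1 fv; elim: (index_enum I) => [|i r IH].
  by under eq_fun do under eq_fun do rewrite big_nil; exact: sq_dominated_cst.
by under eq_fun do under eq_fun do rewrite big_cons; exact: sq_dominatedD.
Qed.

(** Over a one-point index, domination results become closure properties of [sqint], so each is
    proved only once. *)
Lemma sqint_dominated f : sq_dominated (fun _ : unit => 1) (fun=> f) <-> sqint f.
Proof.
split=> [[c _ /(_ tt)[]]//|sf]; exists (\int[Pr]_w (f w ^+ 2)).
  exact: sq_moment_ge0.
by move=> _; rewrite mulr1.
Qed.

End square_integrable.

(** * From operator-norm moments to moments of entries *)

Section matrix_moments.
Context {d : measure_display} {T : measurableType d} {R : realType}.
Variable Pr : probability T R.

(* [g] need not be measurable: it will be the square of [mx_norm2]. *)
Lemma ge0_le_integral_nonmeasurable (f g : T -> \bar R) :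
  (forall w, 0 <= f w)%E -> (forall w, f w <= g w)%E ->
  (\int[Pr]_w f w <= \int[Pr]_w g w)%E.
Proof.
move=> f0 fg; have g0 w := le_trans (f0 w) (fg w).
rewrite !ge0_integralTE//; apply: le_ereal_sup => _ [h hf <-].
by exists h => // w; exact: le_trans (hf w) (fg w).
Qed.

Lemma mx_eucl_ge_entry (p q : nat) (A : 'M[R]_(p, q)) i j : `|A i j| <= mx_eucl A.
Proof.
rewrite -sqrtr_sqr /mx_eucl ler_wsqrtr// (bigD1 i)//= (bigD1 j)//= -addrA lerDl.
rewrite addr_ge0// sumr_ge0// => k _; first exact: sqr_ge0.
by rewrite sumr_ge0// => l _; exact: sqr_ge0.
Qed.

Lemma mx_eucl_sqr (p q : nat) (A : 'M[R]_(p, q)) :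
  mx_eucl A ^+ 2 = \sum_(i < p) \sum_(j < q) A i j ^+ 2.
Proof.
rewrite sqr_sqrtr// sumr_ge0// => i _; rewrite sumr_ge0// => j _; exact: sqr_ge0.
Qed.

(** Column [j] is the image of a unit basis vector, and its Euclidean norm dominates each of its
    entries. *)
Lemma mx_norm2_ge_entry (p q : nat) (A : 'M[R]_(p, q)) i j : `|A i j| <= mx_norm2 A.
Proof.
apply: (@le_trans _ _ (mx_eucl (A *m delta_mx j (0 : 'I_1)))).
  apply: le_trans (mx_eucl_ge_entry _ _ _ i 0).
  rewrite -colE mxE//.
apply: ub_le_sup; last first.
  exists (delta_mx j 0) => //=.
  rewrite /mx_eucl -[leRHS]sqrtr1 ler_wsqrtr// (bigD1 j)//= big_ord1 mxE !eqxx expr1n.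
  rewrite big1 ?addr0// => k kj; rewrite big_ord1 mxE (negPf kj) /= expr0n//.
(* An upper bound is required for [sup] to be a genuine supremum. Entries of [x] have modulus at
   most [1], so each entry of [A *m x] is bounded by the l1 norm of the corresponding row. *)
exists (Num.sqrt (\sum_(k < p) (\sum_(l < q) `|A k l|) ^+ 2)) => _ [x /= x1 <-].
rewrite /mx_eucl ler_wsqrtr// ler_sum// => k _; rewrite big_ord1.
rewrite -(real_normK (num_real _)) lerXn2r ?nnegrE ?sumr_ge0//.
rewrite mxE (le_trans (ler_norm_sum _ _ _))// ler_sum// => l _.
rewrite normrM ler_piMr// (le_trans _ x1)//; exact: mx_eucl_ge_entry.
Qed.

Lemma second_moment_entry (p q : nat) (M : nat -> T -> 'M[R]_(p, q)) :
  (forall s, random_mx (M s)) -> bounded_second_moment Pr M ->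
  exists2 B : R, 0 <= B & forall s i j, sqint Pr (fun w => M s w i j) /\
    \int[Pr]_w (M s w i j ^+ 2) <= B.
Proof.
move=> rM [B MB].
have B0 : 0 <= B.
  rewrite -lee_fin (le_trans _ (MB 0%N))// unlock.
  by apply: integral_ge0 => w _; rewrite lee_fin sqr_ge0.
exists B => // s i j.
have mM : measurable_fun setT (fun w => M s w i j) by exact: rM.
have MsB : (\int[Pr]_w (M s w i j ^+ 2)%:E <= B%:E)%E.
  apply: le_trans (MB s); rewrite unlock; apply: ge0_le_integral_nonmeasurable.
    by move=> w; rewrite lee_fin sqr_ge0.
  move=> w /=; rewrite lee_fin -(real_normK (num_real (M s w i j))).
  have := mx_norm2_ge_entry _ _ (M s w) i j.
  by move=> h; rewrite lerXn2r// nnegrE (le_trans _ h).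
have Ifin : intble Pr (fun w => M s w i j ^+ 2).
  apply/integrableP; split; first by apply/measurable_EFinP; exact: measurable_funX.
  rewrite (le_lt_trans _ (ltry B))// (le_trans _ MsB)// le_eqVlt; apply/orP; left.
  by apply/eqP/eq_integral => w _ /=; rewrite ger0_norm// sqr_ge0.
split => //.
by rewrite -lee_fin /Rintegral fineK//; exact: integrable_fin_num.
Qed.

End matrix_moments.

(** * The averaged map is a max-norm contraction; existence and uniqueness of its fixed point *)

Section fixed_point.
Context {R : realType} {n m : nat}.
Variables (Lam P : 'M[R]_n) (C : 'M[R]_m).
Hypotheses (P_stochastic : row_stochastic P) (C_stochastic : row_stochastic C).
Hypotheses (Lam_diag : is_diag_mx Lam) (Lam_range : forall i, 0 <= Lam i i < 1).

Lemma convex_comb_le (I : finType) (p y : I -> R) (v : R) :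
  (forall i, 0 <= p i) -> \sum_i p i = 1 -> (forall i, `|y i| <= v) ->
  `|\sum_i p i * y i| <= v.
Proof.
move=> p0 p1 yv; rewrite (le_trans (ler_norm_sum _ _ _))//.
rewrite -[leRHS]mul1r -p1 mulr_suml ler_sum// => i _.
by rewrite normrM (ger0_norm (p0 i)) ler_wpM2l.
Qed.

(** Multiplying by [P] on the left and by [C^T] on the right takes convex combinations of entries;
    the diagonal [Lam] then scales row [i] by [Lam i i]. *)
Lemma weighted_average_le (Y : 'M[R]_(n, m)) (v : R) i j :
  (forall l h, `|Y l h| <= v) ->
  `|(Lam *m P *m Y *m C^T) i j| <= Lam i i * v.
Proof.
move=> Yv; have [P0 P1] := P_stochastic; have [C0 C1] := C_stochastic.
have /andP[L0 _] := Lam_range i.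
rewrite mxE; under eq_bigr => h _ do rewrite [C^T _ _]mxE mulrC.
apply: convex_comb_le => // h.
rewrite -mulmxA mxE (bigD1 i)//= big1 ?addr0; last first.
  by move=> k ki; move/is_diag_mxP: Lam_diag => -> //; rewrite ?mul0r// eq_sym.
rewrite normrM (ger0_norm L0) ler_wpM2l// mxE.
exact: convex_comb_le.
Qed.

(** A maximum of finitely many numbers below [1] stays below [1]; starting it at [0] also covers
    [n = 0]. *)
Lemma Lam_le_rho : exists2 rho, 0 <= rho < 1 & forall i, Lam i i <= rho.
Proof.
exists (\big[Num.max/0]_i Lam i i); last by move=> i; exact: (bigmax_sup i).
rewrite bigmax_ge_id/=; apply/bigmax_ltP; split=> // i _.
by have /andP[] := Lam_range i.
Qed.

(** The largest modulus [v] of an entry satisfies [v <= rho * v] with [rho < 1], hence vanishes. *)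
Lemma fixed_point_kernel (Y : 'M[R]_(n, m)) : Y = Lam *m P *m Y *m C^T -> Y = 0.
Proof.
move=> Yfix; have [rho /andP[rho0 rho1] Lrho] := Lam_le_rho.
pose v := \big[Num.max/0]_(p : 'I_n * 'I_m) `|Y p.1 p.2|.
have v0 : 0 <= v by exact: bigmax_ge_id.
have Yv l h : `|Y l h| <= v by exact: (bigmax_sup (l, h)).
have : v <= rho * v.
  apply/bigmax_leP; split=> [|[l h] _ /=]; first exact: mulr_ge0.
  rewrite Yfix (le_trans (weighted_average_le _ _ _ _ Yv))//.
  by rewrite ler_wpM2r.
move=> vr; have v00 : v <= 0 by nra.
apply/matrixP => i j; rewrite mxE; apply/eqP.
by rewrite -normr_le0 (le_trans (Yv i j)).
Qed.

(** In finite dimension the injective endomorphism [\1 - K] is invertible, and the solution is the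
    preimage of [D]. *)
Lemma fixed_point_exists (D : 'M[R]_(n, m)) : exists S : 'M[R]_(n, m),
  unique (fun Y => Y = Lam *m P *m Y *m C^T + D) S.
Proof.
pose K : 'End('M[R]_(n, m)) := linfun (mulmxr C^T \o mulmx (Lam *m P)).
have KE Y : K Y = Lam *m P *m Y *m C^T by rewrite lfunE.
pose f := (\1 - K)%VF.
have fE Y : f Y = Y - Lam *m P *m Y *m C^T.
  by rewrite /f !lfunE /= !lfunE /= KE.
have f_inj : lker f == 0%VS.
  rewrite -subv0; apply/subvP => Y; rewrite memv_ker fE subr_eq0 => /eqP Yfix.
  by rewrite memv0; apply/eqP; exact: fixed_point_kernel.
exists ((f^-1)%VF D); split.
  have := lker0_lfunVK f_inj D; rewrite fE => /eqP; rewrite subr_eq => /eqP {1}->.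
  by rewrite addrC.
move=> Y Yfix; have : f Y = D by rewrite fE {1}Yfix addrAC subrr add0r.
by move=> <-; rewrite lker0_lfunK.
Qed.
End fixed_point.

(** * A deterministic recursion of Robbins-Monro type *)

(* From any [N] on, [u] is bounded by iterating
   [1 - k a + c a^2 <= exp (- k a) exp (c a^2)]; then [N] is taken large. *)
Lemma robbins_monro_cvg0 {R : realType} (a u : R^nat) (k c : R) :
  0 < k -> 0 <= c -> (forall s, 0 <= a s) -> (forall s, 0 <= u s) ->
  (\sum_(0 <= s <oo) (a s)%:E = +oo)%E ->
  (\sum_(0 <= s <oo) ((a s ^+ 2)%R)%:E < +oo)%E ->
  (forall s, u s.+1 <= (1 - k * a s + c * a s ^+ 2) * u s + c * a s ^+ 2) ->
  u @ \oo --> 0.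
Proof.
move=> k0 c0 a0 u0 suma suma2 ustep.
pose A := series a; pose S := series (fun s => a s ^+ 2).
have ASS s : A s.+1 = A s + a s by rewrite /A seriesSr.
have SSS s : S s.+1 = S s + a s ^+ 2 by rewrite /S seriesSr.
have Snd : nondecreasing_seq S.
  apply/nondecreasing_seqP => s; rewrite SSS lerDl sqr_ge0 //.
have S0 s : 0 <= S s by rewrite /S /series /= sumr_ge0// => i _; exact: sqr_ge0.
have Ay : A @ \oo --> +oo%R.
  apply/cvgeryP; rewrite -suma.
  rewrite (_ : (fun x => (A x)%:E) = (fun n => \sum_(0 <= s < n) (a s)%:E)%E).
    have /(_ xpredT 0%N) := @is_cvg_nneseries _ (fun s => (a s)%:E).
    by apply=> s _ _; rewrite lee_fin.
  by apply/funext => n; rewrite /A /series /= sumEFin.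
have [L SL] : exists L : R, S @ \oo --> L.
  have Sge0 : (0 <= \sum_(0 <= s <oo) ((a s ^+ 2)%R)%:E)%E.
    by apply: nneseries_ge0 => s _ _; rewrite lee_fin sqr_ge0.
  exists (fine (\sum_(0 <= s <oo) ((a s ^+ 2)%R)%:E)%E).
  apply: (@fine_cvg R _ \oo _ (fun n => (S n)%:E)); rewrite fineK ?ge0_fin_numE//.
  rewrite (_ : (fun x => (S x)%:E) = (fun n => \sum_(0 <= s < n) (a s ^+ 2)%:E)%E).
    have /(_ xpredT 0%N) := @is_cvg_nneseries _ (fun s => (a s ^+ 2)%:E).
    by apply=> s _ _; rewrite lee_fin sqr_ge0.
  by apply/funext => n; rewrite /S /series /= sumEFin.
have SleL s : S s <= L.
  by rewrite -(cvg_lim _ SL)//; apply: nondecreasing_cvgn_le => //; apply/cvg_ex; exists L.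
(* Discrete Gronwall estimate: decay accumulates in the exponential of [A], growth in that of [S],
   and the additive noise sums to [c * (S (N + s) - S N)]. *)
have bound N s : u (N + s)%N <= expR (c * (S (N + s)%N - S N)) *
    (expR (- k * (A (N + s)%N - A N)) * u N + c * (S (N + s)%N - S N)).
  elim: s => [|s IH]; first by rewrite addn0 !subrr !mulr0 !expR0 !mul1r addr0.
  rewrite addnS; set m := (N + s)%N in IH *.
  have Sm : 0 <= S m - S N by rewrite subr_ge0; exact/Snd/leq_addr.
  have e1 : 1 - k * a m + c * a m ^+ 2 <= expR (- k * a m) * expR (c * a m ^+ 2).
    by rewrite -expRD; apply: le_trans (expR_ge1Dx _); lra.
  apply: le_trans (ustep m) _.
  apply: (@le_trans _ _ (expR (- k * a m) * expR (c * a m ^+ 2) * u m + c * a m ^+ 2)).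
    by rewrite lerD2r ler_wpM2r.
  rewrite ASS SSS.
  have -> : A m + a m - A N = (A m - A N) + a m by ring.
  have -> : S m + a m ^+ 2 - S N = (S m - S N) + a m ^+ 2 by ring.
  rewrite (mulrDr (- k) (A m - A N)) !(mulrDr c (S m - S N)) !expRD.
  set E1 := expR (- k * a m); set E2 := expR (c * a m ^+ 2).
  set q := c * a m ^+ 2.
  set x := S m - S N in Sm IH *.
  set F1 := expR (- k * (A m - A N)) in IH *; set F2 := expR (c * x) in IH *.
  have E10 : 0 <= E1 by exact: expR_ge0.
  have E20 : 0 <= E2 by exact: expR_ge0.
  have q0 : 0 <= q by rewrite /q mulr_ge0// sqr_ge0.
  have E11 : E1 <= 1.
    by rewrite -expR0 ler_expR mulNr oppr_le0 mulr_ge0// ltW.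
  have E21 : 1 <= E2 by rewrite -expR0 ler_expR.
  have F21 : 1 <= F2 by rewrite -expR0 ler_expR mulr_ge0.
  have cx : 0 <= c * x by exact: mulr_ge0.
  apply: (@le_trans _ _ (E1 * E2 * (F2 * (F1 * u N + c * x)) + q)).
    by rewrite lerD2r ler_wpM2l// mulr_ge0.
  have -> : F2 * E2 * (F1 * E1 * u N + (c * x + q)) =
    E1 * E2 * (F2 * (F1 * u N)) + F2 * E2 * (c * x) + F2 * E2 * q by ring.
  (* The fresh noise [q] is at most [F2 * E2 * q] since both factors are at least [1]; in the older
     noise term the factor [E1] is at most [1]. *)
  rewrite mulrDr mulrDr; apply: lerD; last first.
    by rewrite -[leLHS]mul1r ler_wpM2r// (le_trans F21)// ler_peMr// (le_trans _ F21).
  rewrite lerD2l.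
  rewrite (_ : E1 * E2 * (F2 * (c * x)) = E1 * (F2 * E2 * (c * x))); last by ring.
  by rewrite ler_piMl// !mulr_ge0// (le_trans _ F21).
apply/cvgrPdist_lt => e e0.
(* Bounds every growth factor, since [S s - S N <= L]. *)
pose M := expR (c * L).
have M0 : 0 < M by exact: expR_gt0.
(* [N] is chosen first, to make all later noise small through the tail of the convergent series of
   squares. *)
have [N SN] : exists N, M * (c * (L - S N)) < e / 2.
  have : M * (c * (L - S N)) @[N --> \oo] --> 0.
    rewrite -[X in _ --> X](mulr0 M); apply: cvgM; first exact: cvg_cst.
     rewrite -[X in _ --> X](mulr0 c).
    apply: cvgM; first exact: cvg_cst.
     rewrite -[X in _ --> X](subrr L); apply: cvgB => //; exact: cvg_cst.
  move=> /cvgrPdist_lt /(_ (e / 2)) /=; rewrite divr_gt0// => /(_ isT).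
  move=> [N _ /(_ N (leqnn N))]; rewrite sub0r normrN => /(le_lt_trans (ler_norm _)).
  by exists N.
(* With [N] fixed, divergence of [A] makes the decay factor overcome the fixed value [u N]. *)
have : \forall s \near \oo, M * (expR (- k * (A s - A N)) * u N) < e / 2.
  have : M * (expR (- k * (A s - A N)) * u N) @[s --> \oo] --> 0.
    rewrite -[X in _ --> X](mulr0 M); apply: cvgM; first exact: cvg_cst.
     rewrite -[X in _ --> X](mul0r (u N)).
    apply: cvgM; last exact: cvg_cst.
    have kAy : k * (A s - A N) @[s --> \oo] --> +oo.
      apply/cvgryPge => B; move/cvgryPge: Ay => /(_ (B / k + A N)).
      by apply: filterS => s; rewrite -lerBrDr ler_pdivrMr// mulrC.
    under eq_fun do rewrite mulNr.
    exact: (cvg_comp _ _ kAy (@cvgr_expR R)).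
  move=> /cvgrPdist_lt /(_ (e / 2)) /=; rewrite divr_gt0// => /(_ isT).
  by apply: filterS => s; rewrite sub0r normrN => /(le_lt_trans (ler_norm _)).
move=> Hs; near=> s.
rewrite sub0r normrN ger0_norm//.
have Ns : (N <= s)%N by near: s; exact: nbhs_infty_ge.
have := bound N (s - N)%N; rewrite subnKC// => /le_lt_trans; apply.
have Sle : S s - S N <= L - S N by rewrite lerD2r.
have SN0 : 0 <= S s - S N by rewrite subr_ge0; exact: Snd.
apply: (@le_lt_trans _ _ (M * (expR (- k * (A s - A N)) * u N + c * (L - S N)))).
  apply: ler_pM.
  - exact: expR_ge0.
  - by rewrite addr_ge0// mulr_ge0// expR_ge0.
  - rewrite ler_expR ler_wpM2l// (le_trans Sle)//.
    by rewrite gerBl.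
  - by rewrite lerD2l ler_wpM2l.
rewrite mulrDr (splitr e); apply: ltrD => //.
by near: s.
Unshelve. all: by end_near.
Qed.

(** * The filtration generated by the independent factors *)

Section random_products.
Context {d : measure_display} {T : measurableType d} {R : realType}.
Variables (Pr : probability T R) (n m : nat).
Variables (Lams Ps : nat -> T -> 'M[R]_n) (Cs : nat -> T -> 'M[R]_m).
Variables (Lam P : 'M[R]_n) (C : 'M[R]_m).
Hypotheses (Lams_random : forall s, random_mx (Lams s))
  (Ps_random : forall s, random_mx (Ps s))
  (Cs_random : forall s, random_mx (Cs s)).
Hypothesis indep : independent_mx_sequences Pr Lams Ps Cs.
Hypotheses (Lams_mean : forall s, has_mean_mx Pr (Lams s) Lam)
  (Ps_mean : forall s, has_mean_mx Pr (Ps s) P)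
  (Cs_mean : forall s, has_mean_mx Pr (Cs s) C).
Variable B : R.
Hypothesis B0 : 0 <= B.
Hypotheses
  (Lams_sq : forall s i j, sqint Pr (fun w => Lams s w i j) /\
     \int[Pr]_w (Lams s w i j ^+ 2) <= B)
  (Ps_sq : forall s i j, sqint Pr (fun w => Ps s w i j) /\
     \int[Pr]_w (Ps s w i j ^+ 2) <= B)
  (Cs_sq : forall s i j, sqint Pr (fun w => Cs s w i j) /\
     \int[Pr]_w (Cs s w i j ^+ 2) <= B).

(** The family inside [independent_mx_sequences], so that [indep] applies to it by conversion. *)
Definition factor_sigma (k : nat + (nat + nat)) : set (set T) :=
  match k with
  | inl s => sigma_mx (Lams s)
  | inr (inl s) => sigma_mx (Ps s)
  | inr (inr s) => sigma_mx (Cs s)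
  end.

(** Indices of the factors of times before [s]. The nesting adds [Lams], [Ps], [Cs] one at a time,
    in the order in which [intble_step] uses them. *)
Fixpoint past (s : nat) : {fset nat + (nat + nat)} :=
  if s is s'.+1 then
    (inr (inr s') |` (inr (inl s') |` (inl s' |` past s')))%fset
  else fset0.

Lemma past_lt s k : k \in past s ->
  (match k with inl t => t | inr (inl t) => t | inr (inr t) => t end < s)%N.
Proof.
elim: s => // s IH /=; rewrite !in_fset1U.
case/predU1P => [->//|]; case/predU1P => [->//|]; case/predU1P => [->//|].
by move=> /IH /ltnW.
Qed.

Lemma sigma_mx_algebra {p q : nat} (M : T -> 'M[R]_(p, q)) :
  sigma_algebra setT (sigma_mx M).
Proof. exact: smallest_sigma_algebra. Qed.

Lemma sigma_mx_measurable {p q : nat} (M : T -> 'M[R]_(p, q)) :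
  random_mx M -> sigma_mx M `<=` measurable.
Proof.
move=> rM; apply: gen_sigma_measurable => _ [i [j [Y mY <-]]].
exact: rM.
Qed.

Lemma entry_sigma_mx {p q : nat} (M : T -> 'M[R]_(p, q)) i j :
  measurable_fun [set: g_sigma_algebraType (sigma_mx M)] (fun w => M w i j).
Proof.
(* Twice, because [sigma_mx M] is itself generated and [g_sigma_algebraType] generates once more. *)
move=> _ Y mY; do 2 apply: sub_sigma_algebra.
by exists i, j, Y.
Qed.

Lemma factor_sigma_algebra k : sigma_algebra setT (factor_sigma k).
Proof. by case: k => [s|[s|s]]; exact: sigma_mx_algebra. Qed.

Lemma factor_sigma_measurable k : factor_sigma k `<=` measurable.
Proof. by case: k => [s|[s|s]]; exact: sigma_mx_measurable. Qed.

Lemma union_factor_measurable (J : {fset nat + (nat + nat)}) :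
  union_system factor_sigma J `<=` measurable.
Proof. by move=> A [k _]; exact: factor_sigma_measurable. Qed.

(** Measurability for the join of the factors in [J]; [known (past s)] expresses adaptedness, that
    is, being determined before the draws of time [s]. *)
Definition known (J : {fset nat + (nat + nat)}) (f : T -> R) : Prop :=
  measurable_fun [set: g_sigma_algebraType (union_system factor_sigma J)] f.

Lemma known_sub J J' f : {subset J <= J'} -> known J f -> known J' f.
Proof.
move=> JJ' mf _ Y mY; have := mf measurableT Y mY.
by apply: sub_sigma_algebra2 => A [k kJ FA]; exists k => //; exact: JJ'.
Qed.

Lemma known_factor k J f : k \in J ->
  measurable_fun [set: g_sigma_algebraType (factor_sigma k)] f -> known J f.
Proof.
move=> kJ mf _ Y mY; have := mf measurableT Y mY.
by apply: sub_sigma_algebra2 => A FA; exists k.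
Qed.

(** The product is again [known], for the enlarged index set, so further independent factors can be
    multiplied in one by one. *)
Lemma intble_indepM k J f g : k \notin J -> known J f ->
  measurable_fun [set: g_sigma_algebraType (factor_sigma k)] g ->
  intble Pr f -> intble Pr g ->
  [/\ known (k |` J)%fset (fun w => f w * g w),
    intble Pr (fun w => f w * g w) &
    \int[Pr]_w (f w * g w) = \int[Pr]_w f w * \int[Pr]_w g w].
Proof.
move=> kJ mf mg If Ig.
have [Ifg Efg] := expectation_indep Pr _ _ _ _ (union_factor_measurable J)
  (factor_sigma_measurable k) (independent_union Pr _ _ _ factor_sigma_algebra
    factor_sigma_measurable indep kJ) mf mg If Ig.
split=> //; apply: measurable_funM.
  by apply: known_sub mf => i iJ; rewrite in_fset1U iJ orbT.
by apply: known_factor mg; rewrite fset1U1.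
Qed.

Lemma intble_step s f g1 g2 g3 : known (past s) f ->
  measurable_fun [set: g_sigma_algebraType (sigma_mx (Lams s))] g1 ->
  measurable_fun [set: g_sigma_algebraType (sigma_mx (Ps s))] g2 ->
  measurable_fun [set: g_sigma_algebraType (sigma_mx (Cs s))] g3 ->
  intble Pr f -> intble Pr g1 -> intble Pr g2 -> intble Pr g3 ->
  [/\ known (past s.+1) (fun w => f w * g1 w * g2 w * g3 w),
    intble Pr (fun w => f w * g1 w * g2 w * g3 w) &
    \int[Pr]_w (f w * g1 w * g2 w * g3 w) =
    \int[Pr]_w f w * \int[Pr]_w g1 w * \int[Pr]_w g2 w * \int[Pr]_w g3 w].
Proof.
move=> mf mg1 mg2 mg3 If I1 I2 I3.
have nL : inl s \notin past s.
  by apply/negP => /past_lt; rewrite ltnn.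
have nP : inr (inl s) \notin (inl s |` past s)%fset.
  by rewrite in_fset1U /=; apply/negP => /past_lt; rewrite ltnn.
have nC : inr (inr s) \notin (inr (inl s) |` (inl s |` past s))%fset.
  by rewrite !in_fset1U /=; apply/negP => /past_lt; rewrite ltnn.
have [k1 i1 <-] := intble_indepM (inl s) _ _ _ nL mf mg1 If I1.
have [k2 i2 <-] := intble_indepM (inr (inl s)) _ _ _ nP k1 mg2 i1 I2.
by have [k3 i3 <-] := intble_indepM (inr (inr s)) _ _ _ nC k2 mg3 i2 I3.
Qed.

(** * First and second moments of the random matrix products *)

Lemma mulmx4E (L Q : 'M[R]_n) (Y : 'M[R]_(n, m)) (D : 'M[R]_m) i j :
  (L *m Q *m Y *m D^T) i j = \sum_(p : 'I_m * ('I_n * 'I_n))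
    Y p.2.1 p.1 * L i p.2.2 * Q p.2.2 p.2.1 * D j p.1.
Proof.
rewrite -(pair_big xpredT xpredT (fun h q => Y q.1 h * L i q.2 * Q q.2 q.1 * D j h)) /=.
rewrite mxE; apply: eq_bigr => h _.
rewrite -(pair_big xpredT xpredT (fun l k => Y l h * L i k * Q k l * D j h)) /=.
rewrite !mxE mulr_suml; apply: eq_bigr => l _.
rewrite mxE !mulr_suml; apply: eq_bigr => k _.
by ring.
Qed.

Let mean_entry (p q : nat) (M : T -> 'M[R]_(p, q)) A i j :
  has_mean_mx Pr M A -> \int[Pr]_w M w i j = A i j.
Proof. by move=> /(_ i j); rewrite unlock /Rintegral => ->. Qed.

Lemma product_mean s (f : T -> R) (Y : T -> 'M[R]_(n, m)) i j :
  known (past s) f -> (forall l h, known (past s) (fun w => Y w l h)) ->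
  (forall l h, intble Pr (fun w => f w * Y w l h)) ->
  intble Pr (fun w => f w * (Lams s w *m Ps s w *m Y w *m (Cs s w)^T) i j) /\
  \int[Pr]_w (f w * (Lams s w *m Ps s w *m Y w *m (Cs s w)^T) i j) =
  (Lam *m P *m (\matrix_(l, h) \int[Pr]_w (f w * Y w l h)) *m C^T) i j.
Proof.
move=> kf kY IfY.
pose g (p : 'I_m * ('I_n * 'I_n)) w := f w * Y w p.2.1 p.1 * Lams s w i p.2.2 *
  Ps s w p.2.2 p.2.1 * Cs s w j p.1.
have gE p : intble Pr (g p) /\ \int[Pr]_w g p w =
    \int[Pr]_w (f w * Y w p.2.1 p.1) * Lam i p.2.2 * P p.2.2 p.2.1 * C j p.1.
  have [||||||||_ Ig ->] := intble_step s (fun w => f w * Y w p.2.1 p.1)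
    (fun w => Lams s w i p.2.2) (fun w => Ps s w p.2.2 p.2.1)
    (fun w => Cs s w j p.1).
  - by apply: measurable_funM; [exact: kf|exact: kY].
  - exact: entry_sigma_mx.
  - exact: entry_sigma_mx.
  - exact: entry_sigma_mx.
  - exact: IfY.
  - exact/intble_sqint/(Lams_sq s _ _).1.
  - exact/intble_sqint/(Ps_sq s _ _).1.
  - exact/intble_sqint/(Cs_sq s _ _).1.
  - by rewrite !(mean_entry _ _ _ _ _ _ (Lams_mean s), mean_entry _ _ _ _ _ _ (Ps_mean s),
      mean_entry _ _ _ _ _ _ (Cs_mean s)).
have -> : (fun w => f w * (Lams s w *m Ps s w *m Y w *m (Cs s w)^T) i j) =
    (fun w => \sum_p g p w).
  apply/funext => w; rewrite mulmx4E mulr_sumr; apply: eq_bigr => p _.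
  by rewrite /g !mulrA.
have [Ig ->] := intble_sum Pr _ g (fun p => (gE p).1).
split=> //; rewrite mulmx4E; apply: eq_bigr => p _.
by rewrite (gE p).2 mxE.
Qed.

Lemma product_known s (Y : T -> 'M[R]_(n, m)) i j :
  (forall l h, known (past s) (fun w => Y w l h)) ->
  known (past s.+1) (fun w => (Lams s w *m Ps s w *m Y w *m (Cs s w)^T) i j).
Proof.
move=> kY; under eq_fun do rewrite mulmx4E.
apply: measurable_sum => p; apply: measurable_funM; [apply: measurable_funM;
  [apply: measurable_funM|]|].
- by apply: known_sub (kY _ _) => k kp; rewrite /= !in_fset1U kp !orbT.
- apply: (known_factor (inl s)); last exact: entry_sigma_mx.
  by rewrite /= !in_fset1U eqxx !orbT.
- apply: (known_factor (inr (inl s))); last exact: entry_sigma_mx.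
  by rewrite /= !in_fset1U eqxx !orbT.
- apply: (known_factor (inr (inr s))); last exact: entry_sigma_mx.
  by rewrite /= !in_fset1U eqxx.
Qed.

(** By independence the second moment of a monomial is the product of the second moments, so moments
    of order two of the factors suffice. The map [e] assigns a time to each index: the identity for
    the process, a constant for a single time. *)
Lemma product_dominated {S : Type} (e : S -> nat) (v : S -> R)
    (Y : S -> T -> 'M[R]_(n, m)) i j :
  (forall s, 1 <= v s) ->
  (forall s l h, known (past (e s)) (fun w => Y s w l h)) ->
  (forall l h, sq_dominated Pr v (fun s w => Y s w l h)) ->
  sq_dominated Pr v (fun s w =>
    (Lams (e s) w *m Ps (e s) w *m Y s w *m (Cs (e s) w)^T) i j).
Proof.
move=> v1 kY Yv.
under eq_fun do under eq_fun do rewrite mulmx4E.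
apply: sq_dominated_sum => // -[h [l k]] /=.
(* One factor [B] for each of the three random entries. *)
have [c c0 cY] := Yv l h; exists (c * (B * B * B)); first by rewrite !mulr_ge0.
move=> s; have [sY Ys] := cY s.
have [sL Ls] := Lams_sq (e s) i k; have [sP Psq] := Ps_sq (e s) k l.
have [sC Csq] := Cs_sq (e s) j h.
have [||||||||_ Ig Eg] := intble_step (e s) (fun w => Y s w l h ^+ 2)
  (fun w => Lams (e s) w i k ^+ 2) (fun w => Ps (e s) w k l ^+ 2)
  (fun w => Cs (e s) w j h ^+ 2).
- by apply: measurable_funX; exact: kY.
- by apply: measurable_funX; exact: entry_sigma_mx.
- by apply: measurable_funX; exact: entry_sigma_mx.
- by apply: measurable_funX; exact: entry_sigma_mx.
- exact: sY.2.
- exact: sL.2.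
- exact: sP.2.
- exact: sC.2.
split.
  split; last by under eq_fun do rewrite !exprMn.
  by apply: measurable_funM sC.1; apply: measurable_funM sP.1;
    apply: measurable_funM sL.1; exact: sY.1.
under eq_Rintegral do rewrite !exprMn.
rewrite Eg.
have -> : c * (B * B * B) * v s = c * v s * B * B * B by ring.
by do 3 (apply: ler_pM => //; rewrite ?mulr_ge0 ?sq_moment_ge0//).
Qed.

Lemma affine_mean s (f : T -> R) (X0 : 'M[R]_(n, m)) i j :
  known (past s) f -> intble Pr f ->
  intble Pr (fun w => f w * (Lams s w *m X0) i j) /\
  \int[Pr]_w (f w * (Lams s w *m X0) i j) = \int[Pr]_w f w * (Lam *m X0) i j.
Proof.
move=> kf If.
pose g k w := X0 k j * (f w * Lams s w i k).
have gE k : intble Pr (g k) /\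
    \int[Pr]_w g k w = X0 k j * (\int[Pr]_w f w * Lam i k).
  have nL : inl s \notin past s by apply/negP => /past_lt; rewrite ltnn.
  have IL := intble_sqint _ _ (Lams_sq s i k).1.
  have [_ Ifg Efg] := intble_indepM (inl s) _ _ _ nL kf (entry_sigma_mx (Lams s) i k) If IL.
  split; first exact: intbleZ.
  by rewrite RintegralZl// Efg (mean_entry _ _ _ _ _ _ (Lams_mean s)).
have -> : (fun w => f w * (Lams s w *m X0) i j) = (fun w => \sum_k g k w).
  apply/funext => w; rewrite mxE mulr_sumr; apply: eq_bigr => k _.
  by rewrite /g mulrA mulrC.
have [Ig ->] := intble_sum Pr _ g (fun k => (gE k).1).
split=> //; rewrite mxE mulr_sumr; apply: eq_bigr => k _.
by rewrite (gE k).2 mulrC mulrA.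
Qed.

Lemma affine_known s (X0 : 'M[R]_(n, m)) i j :
  known (past s.+1) (fun w => (Lams s w *m X0) i j).
Proof.
under eq_fun do rewrite mxE.
apply: measurable_sum => k; apply: measurable_funM; last exact: measurable_cst.
apply: (known_factor (inl s)); last exact: entry_sigma_mx.
by rewrite /= !in_fset1U eqxx !orbT.
Qed.

Lemma affine_dominated {S : Type} (e : S -> nat) (v : S -> R)
    (X0 : 'M[R]_(n, m)) i j :
  (forall s, 1 <= v s) ->
  sq_dominated Pr v (fun s w => (Lams (e s) w *m X0) i j).
Proof.
move=> v1; under eq_fun do under eq_fun do rewrite mxE.
apply: sq_dominated_sum => // k.
under eq_fun do under eq_fun do rewrite mulrC.
apply: sq_dominatedZ; exists B => // s; have [sL Ls] := Lams_sq (e s) i k.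
by split=> //; rewrite (le_trans Ls)// ler_peMr.
Qed.


(** * The drift of the error: adaptedness, second moment and mean *)

Section error_process.
Variables (X0 Xs : 'M[R]_(n, m)).
Hypothesis Xs_fix : Xs = Lam *m P *m Xs *m C^T + (1%:M - Lam) *m X0.

(** The first line is linear in [Y]; the bracket is free of [Y] and has mean zero by [Xs_fix]. *)
Definition drift s (Y : 'M[R]_(n, m)) w : 'M[R]_(n, m) :=
  Lams s w *m Ps s w *m Y *m (Cs s w)^T - Y
  + (Lams s w *m Ps s w *m Xs *m (Cs s w)^T - Lams s w *m X0 + (X0 - Xs)).

(** Differences become multiples by [-1], so that the closure lemmas for sums and scalar multiples
    apply. *)
Lemma driftE s Y w i j : drift s Y w i j =
  (Lams s w *m Ps s w *m Y *m (Cs s w)^T) i j + -1 * Y i j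
  + ((Lams s w *m Ps s w *m Xs *m (Cs s w)^T) i j + -1 * (Lams s w *m X0) i j
     + (X0 - Xs) i j).
Proof. by rewrite !mulN1r /drift; do 5 rewrite mxE [X in _ = X]/=; rewrite !mxE. Qed.

Lemma known_cst J (k : R) : known J (fun=> k).
Proof. exact: measurable_cst. Qed.

Lemma drift_dominated {S : Type} (e : S -> nat) (v : S -> R)
    (Y : S -> T -> 'M[R]_(n, m)) i j :
  (forall s, 1 <= v s) ->
  (forall s l h, known (past (e s)) (fun w => Y s w l h)) ->
  (forall l h, sq_dominated Pr v (fun s w => Y s w l h)) ->
  sq_dominated Pr v (fun s w => drift (e s) (Y s w) w i j).
Proof.
move=> v1 kY Yv; under eq_fun do under eq_fun do rewrite driftE.
apply: sq_dominatedD; [apply: sq_dominatedD|apply: sq_dominatedD;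
  [apply: sq_dominatedD|]].
- exact: product_dominated.
- exact: sq_dominatedZ.
- apply: (product_dominated e v (fun _ _ => Xs)) => // [s l h|l h].
    exact: known_cst.
  exact: sq_dominated_cst.
- by apply: sq_dominatedZ; exact: affine_dominated.
- exact: sq_dominated_cst.
Qed.

Lemma drift_known s (Y : T -> 'M[R]_(n, m)) i j :
  (forall l h, known (past s) (fun w => Y w l h)) ->
  known (past s.+1) (fun w => drift s (Y w) w i j).
Proof.
move=> kY; under eq_fun do rewrite driftE.
apply: measurable_funD; [apply: measurable_funD|apply: measurable_funD;
  [apply: measurable_funD|]].
- exact: product_known.
- apply: measurable_funM; first exact: measurable_cst.
  by apply: known_sub (kY _ _) => k kp; rewrite /= !in_fset1U kp !orbT.
- by apply: (product_known s (fun=> Xs)) => l h; exact: known_cst.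
- apply: measurable_funM; first exact: measurable_cst.
  exact: affine_known.
- exact: measurable_cst.
Qed.

Lemma drift_mean s (Y : T -> 'M[R]_(n, m)) i j :
  (forall l h, known (past s) (fun w => Y w l h)) ->
  (forall l h, sqint Pr (fun w => Y w l h)) ->
  \int[Pr]_w (Y w i j * drift s (Y w) w i j) =
  (Lam *m P *m (\matrix_(l, h) \int[Pr]_w (Y w i j * Y w l h)) *m C^T) i j
  - \int[Pr]_w (Y w i j ^+ 2).
Proof.
move=> kY sY; set y := fun w => Y w i j.
have Iy : intble Pr y := intble_sqint _ _ (sY i j).
have [I1 E1] := product_mean s y Y i j (kY i j) kY
  (fun l h => intble_mul_sqint _ _ _ (sY i j) (sY l h)).
have IyX l h : intble Pr (fun w => y w * Xs l h).
  by under eq_fun do rewrite mulrC; exact: intbleZ.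
have [I2 E2] := product_mean s y (fun=> Xs) i j (kY i j)
  (fun l h => known_cst _ _) IyX.
have [I3 E3] := affine_mean s y X0 i j (kY i j) Iy.
have I4 : intble Pr (fun w => (X0 - Xs) i j * y w) by exact: intbleZ.
have Iyy : intble Pr (fun w => -1 * y w ^+ 2) by apply: intbleZ; exact: (sY i j).2.
transitivity (\int[Pr]_w
   ((y w * (Lams s w *m Ps s w *m Y w *m (Cs s w)^T) i j + -1 * y w ^+ 2) +
   ((y w * (Lams s w *m Ps s w *m Xs *m (Cs s w)^T) i j +
     -1 * (y w * (Lams s w *m X0) i j)) + (X0 - Xs) i j * y w))).
  by apply: eq_Rintegral => w _; rewrite driftE -/(y w); ring.
have I3' : intble Pr (fun w => -1 * (y w * (Lams s w *m X0) i j)) by exact: intbleZ.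
have I12 := intbleD _ _ _ I1 Iyy.
have I23 := intbleD _ _ _ I2 I3'.
have I234 := intbleD _ _ _ I23 I4.
rewrite (RintegralD measurableT I12 I234) (RintegralD measurableT I1 Iyy).
rewrite (RintegralD measurableT I23 I4) (RintegralD measurableT I2 I3').
rewrite !RintegralZl//; last exact: (sY i j).2.
rewrite E1 E2 E3.
have -> : (\matrix_(l, h) \int[Pr]_w (y w * Xs l h)) = (\int[Pr]_w y w) *: Xs.
  apply/matrixP => l h; rewrite !mxE; under eq_Rintegral do rewrite mulrC.
  by rewrite RintegralZl// mulrC.
(* The fixed-point equation at entry [(i, j)] cancels all terms proportional to the mean of [y]. *)
have := congr1 (fun M : 'M[R]_(n, m) => M i j) Xs_fix.
rewrite -scalemxAr -scalemxAl mulmxBl mul1mx.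
rewrite [X in _ = X -> _]mxE [(X0 - Lam *m X0) i j]mxE [(- (Lam *m X0)) i j]mxE.
rewrite [(_ *: (_ *m C^T)) i j]mxE [(X0 - Xs) i j]mxE [(- Xs) i j]mxE => fixE.
by rewrite [in X in _ + X]fixE; ring.
Qed.

(** * Second moments of the error process and their recursion *)

Variables (a : nat -> R) (Z : nat -> T -> 'M[R]_(n, m)) (Z0 : 'M[R]_(n, m)).
Hypothesis Z_init : forall w, Z 0%N w = Z0.
Hypothesis Z_step : forall s w, Z s.+1 w = Z s w + a s *: drift s (Z s w) w.

Lemma error_stepE s w i j : Z s.+1 w i j = Z s w i j + a s * drift s (Z s w) w i j.
Proof. by rewrite Z_step !mxE. Qed.

Lemma error_known s i j : known (past s) (fun w => Z s w i j).
Proof.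
elim: s i j => [|s IH] i j.
  by under eq_fun do rewrite Z_init; exact: known_cst.
under eq_fun do rewrite error_stepE.
apply: measurable_funD.
  by apply: known_sub (IH _ _) => k kp; rewrite /= !in_fset1U kp !orbT.
by apply: measurable_funM; [exact: measurable_cst|exact: drift_known].
Qed.

Lemma drift_sqint s i j : (forall l h, sqint Pr (fun w => Z s w l h)) ->
  sqint Pr (fun w => drift s (Z s w) w i j).
Proof.
move=> sZ; apply/sqint_dominated.
apply: (drift_dominated (fun _ : unit => s) _ (fun=> Z s)) => //.
  by move=> _; exact: error_known.
by move=> l h; apply/sqint_dominated.
Qed.

Lemma error_sqint s i j : sqint Pr (fun w => Z s w i j).
Proof.
elim: s i j => [|s IH] i j.
  by under eq_fun do rewrite Z_init; exact: sqint_cst.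
under eq_fun do rewrite error_stepE.
by apply: sqintD => //; apply: sqintZ; exact: drift_sqint.
Qed.

(** The quantity called [u] in the overview; the default [0] covers empty matrices. *)
Definition error_sup s : R :=
  \big[Num.max/0]_(p : 'I_n * 'I_m) \int[Pr]_w (Z s w p.1 p.2 ^+ 2).

Lemma error_sup_ge0 s : 0 <= error_sup s.
Proof. exact: bigmax_ge_id. Qed.

Lemma error_moment_le s i j : \int[Pr]_w (Z s w i j ^+ 2) <= error_sup s.
Proof. exact: (bigmax_sup (i, j)). Qed.

Lemma drift_moment_le : exists2 c, 0 <= c & forall s i j,
  \int[Pr]_w (drift s (Z s w) w i j ^+ 2) <= c * (error_sup s + 1).
Proof.
have dom (p : 'I_n * 'I_m) : exists c, 0 <= c /\ forall s,
    \int[Pr]_w (drift s (Z s w) w p.1 p.2 ^+ 2) <= c * (error_sup s + 1).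
  have [||l h|c c0 cP] := drift_dominated id (fun s => error_sup s + 1) Z p.1 p.2.
  - by move=> s; rewrite lerDr error_sup_ge0.
  - exact: error_known.
  - exists 1 => // s; split; first exact: error_sqint.
    by rewrite mul1r (le_trans (error_moment_le _ _ _))// lerDl.
  - by exists c; split=> // s; exact: (cP s).2.
have [c cP] := choice dom.
(* Summing the nonnegative constants of the entries gives one constant valid for all of them. *)
exists (\sum_p c p); first by rewrite sumr_ge0// => p _; exact: (cP p).1.
move=> s i j; apply: le_trans ((cP (i, j)).2 s) _.
rewrite ler_wpM2r ?addr_ge0 ?error_sup_ge0//.
by rewrite (bigD1 (i, j))//= lerDl sumr_ge0// => p _; exact: (cP p).1.
Qed.

Hypotheses (P_stochastic : row_stochastic P) (C_stochastic : row_stochastic C).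
Hypotheses (Lam_diag : is_diag_mx Lam) (Lam_range : forall i, 0 <= Lam i i < 1).
Hypothesis a_ge0 : forall s, 0 <= a s.

Lemma error_moment_step s i j :
  \int[Pr]_w (Z s.+1 w i j ^+ 2) =
  \int[Pr]_w (Z s w i j ^+ 2)
  + 2 * a s * \int[Pr]_w (Z s w i j * drift s (Z s w) w i j)
  + a s ^+ 2 * \int[Pr]_w (drift s (Z s w) w i j ^+ 2).
Proof.
have sZ := error_sqint s i j.
have sD := drift_sqint s i j (error_sqint s).
have I1 := sZ.2; have I3 := sD.2; have I2 := intble_mul_sqint _ _ _ sZ sD.
have J2 : intble Pr (fun w => 2 * a s * (Z s w i j * drift s (Z s w) w i j)).
  exact: intbleZ.
have J3 : intble Pr (fun w => a s ^+ 2 * drift s (Z s w) w i j ^+ 2).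
  exact: intbleZ.
rewrite -!RintegralZl// -(RintegralD measurableT I1 J2).
rewrite -(RintegralD measurableT (intbleD _ _ _ I1 J2) J3).
by apply: eq_Rintegral => w _; rewrite error_stepE; ring.
Qed.

Lemma error_sup_step : exists k c, [/\ 0 < k, 0 <= c & forall s,
  error_sup s.+1 <=
  (1 - k * a s + c * a s ^+ 2) * error_sup s + c * a s ^+ 2].
Proof.
have [rho /andP[rho0 rho1] Lrho] := Lam_le_rho Lam Lam_range.
have [c c0 cP] := drift_moment_le.
(* [2 * (1 - rho)] is twice the contraction gap; [c] comes from the drift, and [4] compensates a
   possibly negative [1 - 2 * a s]. *)
exists (2 * (1 - rho)), (4 + c); split; [by lra|by lra|] => s.
have u0 := error_sup_ge0 s.
(* [weighted_average_le] is applied to the matrix of cross moments of [Z s w i j] with all entries,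
   each bounded by [error_sup s]. *)
have corr i j : \int[Pr]_w (Z s w i j * drift s (Z s w) w i j) <=
    rho * error_sup s - \int[Pr]_w (Z s w i j ^+ 2).
  rewrite drift_mean; last 2 first.
    exact: error_known.
    exact: error_sqint.
  rewrite lerD2r (le_trans (ler_norm _))//.
  apply: le_trans (weighted_average_le _ _ _ P_stochastic C_stochastic Lam_diag
    Lam_range _ (error_sup s) i j _) _; last by rewrite ler_wpM2r.
  move=> l h; rewrite mxE; apply: abs_cross_moment_le;
    by [exact: error_sqint|exact: error_moment_le].
have a0 := a_ge0 s.
apply/bigmax_leP; split=> [|[i j] _ /=].
  (* The maximum starts from [0], so the right-hand side must itself be nonnegative. *)
  have : 0 <= 1 - 2 * (1 - rho) * a s + 4 * a s ^+ 2.
    have := sqr_ge0 (1 - 2 * a s); have : 0 <= rho * a s by exact: mulr_ge0.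
    have := sqr_ge0 (a s); nra.
  move=> h; have h' : 0 <= (4 + c) * a s ^+ 2.
    by rewrite mulr_ge0 ?sqr_ge0//; lra.
  by rewrite addr_ge0// mulr_ge0//; have := sqr_ge0 (a s); nra.
rewrite error_moment_step.
set q := \int[Pr]_w (Z s w i j ^+ 2).
have qu : q <= error_sup s := error_moment_le s i j.
have t2 : 2 * a s * \int[Pr]_w (Z s w i j * drift s (Z s w) w i j) <=
    2 * a s * (rho * error_sup s - q).
  by rewrite ler_wpM2l ?corr// mulr_ge0.
have t3 : a s ^+ 2 * \int[Pr]_w (drift s (Z s w) w i j ^+ 2) <=
    a s ^+ 2 * (c * (error_sup s + 1)).
  by rewrite ler_wpM2l ?cP// sqr_ge0.
(* [1 - 2 a] may be negative, but [1 - 2 a + 4 a ^+ 2] never is. *)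
have t1 : (1 - 2 * a s + 4 * a s ^+ 2) * q <=
    (1 - 2 * a s + 4 * a s ^+ 2) * error_sup s.
  by rewrite ler_wpM2l//; have := sqr_ge0 (1 - 2 * a s); have := sqr_ge0 (a s); nra.
have t4 : 0 <= 4 * a s ^+ 2 * q.
  by rewrite mulr_ge0 ?sq_moment_ge0// mulr_ge0// sqr_ge0.
have t5 : 0 <= a s ^+ 2 by exact: sqr_ge0.
by lra.
Qed.

Hypothesis a_sum : (\sum_(0 <= s <oo) (a s)%:E = +oo)%E.
Hypothesis a_sqr_sum : (\sum_(0 <= s <oo) ((a s ^+ 2)%R)%:E < +oo)%E.

(** The expected squared norm is the sum of the entrywise second moments, squeezed between [0] and
    the number of entries times [error_sup s]. *)
Lemma error_cvg_mean_square :
  ('E_Pr[fun w => (mx_eucl (Z s w) ^+ 2)%R])%E @[s --> \oo] --> 0%:E.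
Proof.
have [k [c [k0 c0 ustep]]] := error_sup_step.
have ucvg : error_sup @ \oo --> 0.
  exact: (robbins_monro_cvg0 a error_sup k c k0 c0 a_ge0 error_sup_ge0 a_sum a_sqr_sum ustep).
have EZ s : ('E_Pr[fun w => (mx_eucl (Z s w) ^+ 2)%R])%E =
    (\sum_(p : 'I_n * 'I_m) \int[Pr]_w (Z s w p.1 p.2 ^+ 2))%:E.
  have [Is <-] := intble_sum Pr _ (fun (p : 'I_n * 'I_m) w => Z s w p.1 p.2 ^+ 2)
    (fun p => (error_sqint s p.1 p.2).2).
  rewrite unlock /Rintegral fineK; last exact: integrable_fin_num.
  by apply: eq_integral => w _; rewrite mx_eucl_sqr pair_big.
under eq_fun do rewrite EZ.
apply: cvg_EFin; first by near=> s.
apply: (@squeeze_cvgr _ _ _ _ (fun=> 0)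
  (fun s => \sum_(p : 'I_n * 'I_m) error_sup s)).
- near=> s; rewrite sumr_ge0/=; last by move=> p _; exact: sq_moment_ge0.
  by apply: ler_sum => p _; exact: error_moment_le.
- exact: cvg_cst.
- under eq_fun do rewrite sumr_const -mulr_natl.
  have : #|{: 'I_n * 'I_m}|%:R * error_sup s @[s --> \oo] -->
      (#|{: 'I_n * 'I_m}|%:R * 0 : R).
    by apply: cvgM => //; exact: cvg_cst.
  by rewrite mulr0.
Unshelve. all: by end_near.
Qed.

End error_process.
End random_products.

(** * Mean-square convergence to the unique fixed point *)

Theorem proposition4p1 (R : realType) (d : measure_display)
  (T : measurableType d) (Pr : probability T R) (n m : nat)
  (a : nat -> R)
  (Lams Ps : nat -> T -> 'M[R]_n) (Cs : nat -> T -> 'M[R]_m)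
  (Lam P : 'M[R]_n) (C : 'M[R]_m)
  (X : nat -> T -> 'M[R]_(n, m)) (X0 : 'M[R]_(n, m))
  (X_init : forall w, X 0%N w = X0)
  (X_step : forall s w, X s.+1 w =
     (1 - a s) *: X s w
     + a s *: (Lams s w *m Ps s w *m X s w *m (Cs s w)^T
               + (1%:M - Lams s w) *m X0))
  (Lams_random : forall s, random_mx (Lams s))
  (Ps_random : forall s, random_mx (Ps s))
  (Cs_random : forall s, random_mx (Cs s))
  (indep : independent_mx_sequences Pr Lams Ps Cs)
  (Lams_mean : forall s, has_mean_mx Pr (Lams s) Lam)
  (Ps_mean : forall s, has_mean_mx Pr (Ps s) P)
  (Cs_mean : forall s, has_mean_mx Pr (Cs s) C)
  (Lams_bounded : bounded_second_moment Pr Lams)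
  (Ps_bounded : bounded_second_moment Pr Ps)
  (Cs_bounded : bounded_second_moment Pr Cs)
  (P_stochastic : row_stochastic P)
  (C_stochastic : row_stochastic C)
  (Lam_diag : is_diag_mx Lam)
  (Lam_range : forall i, 0 <= Lam i i < 1)
  (a_ge0 : forall s, 0 <= a s)
  (a_sum : (\sum_(0 <= s <oo) (a s)%:E = +oo)%E)
  (a_sqr_sum : (\sum_(0 <= s <oo) ((a s ^+ 2)%R)%:E < +oo)%E) :
  exists Xstar : 'M[R]_(n, m),
    unique (fun Y : 'M[R]_(n, m) =>
              Y = Lam *m P *m Y *m C^T + (1%:M - Lam) *m X0) Xstar
    /\ cvg_mean_square Pr X Xstar.
Proof.
have [Xs Xs_unique] := fixed_point_exists Lam P C P_stochastic C_stochastic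
  Lam_diag Lam_range ((1%:M - Lam) *m X0).
exists Xs; split=> //; have [Xs_fix _] := Xs_unique.
have [B1 B10 LB] := second_moment_entry Pr n n Lams Lams_random Lams_bounded.
have [B2 B20 PB] := second_moment_entry Pr n n Ps Ps_random Ps_bounded.
have [B3 B30 CB] := second_moment_entry Pr m m Cs Cs_random Cs_bounded.
(* The sum serves as a common bound for the three sequences. *)
have B0 : 0 <= B1 + B2 + B3 by rewrite !addr_ge0.
apply: (error_cvg_mean_square Pr n m Lams Ps Cs Lam P C Lams_random Ps_random
  Cs_random indep Lams_mean Ps_mean Cs_mean (B1 + B2 + B3) B0 _ _ _ X0 Xs Xs_fix
  a (fun s w => X s w - Xs) (X0 - Xs) _ _ P_stochastic C_stochastic Lam_diag
  Lam_range a_ge0 a_sum a_sqr_sum).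
- by move=> s i j; have [? h] := LB s i j; split=> //; lra.
- by move=> s i j; have [? h] := PB s i j; split=> //; lra.
- by move=> s i j; have [? h] := CB s i j; split=> //; lra.
- by move=> w; rewrite X_init.
(* An algebraic identity: the terms in [Xs] cancel inside [drift] evaluated at [X s w - Xs]. *)
- move=> s w; rewrite X_step /drift mulmxBr !mulmxBl mul1mx.
  by apply/matrixP => i j; rewrite !mxE; ring.
Qed.
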